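(* (i) If $G$ is a nilpotent-by-cyclic non-Engel group, then the Engel graph $\mathcal{E}_G$ is connected and its diameter is at most $6$. (ii) If $G$ is a nilpotent-by-abelian group and $x\in G\setminus L(G)$, then the normal closure $\langle x\rangle^G$ is non-Engel, $\mathcal{E}_{\langle x\rangle^G}$ is connected with diameter at most $6$, and the induced subgraph of $\mathcal{E}_G$ on the conjugacy class of $x$ in $G$ is connected with diameter at most $2$.
   Context: For elements of a group, $[x,y]=x^{-1}y^{-1}xy$, and $[x,_k y]$ is defined by $[x,_0 y]=x$, $[x,_k y]=[[x,_{k-1}y],y]$ for $k\ge 1$. An element $x\in G$ is left Engel if for every $a\in G$ there is a positive integer $k$ with $[a,_k x]=1$; $L(G)$ is the set of left Engel elements of $G$. $G$ is an Engel group if $L(G)=G$, and non-Engel otherwise. For a non-Engel group $G$, the Engel graph $\mathcal{E}_G$ is the simple graph with vertex set $G\setminus L(G)$ in which two distinct vertices $x,y$ are adjacent iff $[x,_k y]\neq 1$ and $[y,_k x]\neq 1$ for all positive integers $k$. A group is nilpotent-by-cyclic (nilpotent-by-abelian) if it has a nilpotent normal subgroup with cyclic (abelian) quotient. The diameter of a connected graph is the largest distance between pairs of its vertices (distance = length of a shortest path). *)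

(* Defs.v *)
From HB Require Import structures.
From mathcomp Require Import all_boot all_classical.

Set Implicit Arguments.
Unset Strict Implicit.
Unset Printing Implicit Defensive.

Local Open Scope classical_set_scope.
Local Open Scope group_scope.

Section Graphs.
Variable T : choiceType.

Record sgraph := SGraph {
  vertices : set T;
  adj : rel T;
  adj_vertices : forall x y, adj x y -> vertices x /\ vertices y;
  adj_sym : symmetric adj;
  adj_irrefl : irreflexive adj }.

Implicit Type D : sgraph.

Lemma induced_vertices D (A : set T) x y :
  [&& adj D x y, x \in A & y \in A] ->
  (vertices D `&` A) x /\ (vertices D `&` A) y.
Proof.
case/and3P=> /adj_vertices[Dx Dy] Ax Ay.
by split; split=> //; apply: set_mem.
Qed.

Lemma induced_sym D (A : set T) :
  symmetric (fun x y => [&& adj D x y, x \in A & y \in A]).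
Proof. by move=> x y; rewrite adj_sym [(x \in A) && _]andbC. Qed.

Lemma induced_irrefl D (A : set T) :
  irreflexive (fun x y => [&& adj D x y, x \in A & y \in A]).
Proof. by move=> x; rewrite adj_irrefl. Qed.

Definition induced D (A : set T) : sgraph :=
  SGraph (@induced_vertices D A) (@induced_sym D A) (@induced_irrefl D A).

(* [x :: p] is a path from [x] to [y]; its length is [size p]. *)
Definition path_between D (x y : T) (p : seq T) : Prop :=
  [/\ vertices D x, path (adj D) x p, uniq (x :: p) & last x p = y].

Definition is_distance D (x y : T) (n : nat) : Prop :=
  (exists2 p, path_between D x y p & size p = n) /\
  (forall p, path_between D x y p -> n <= size p).

Definition connected_graph D : Prop :=
  forall x y, vertices D x -> vertices D y -> exists p, path_between D x y p.

Definition is_diameter D (d : nat) : Prop :=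
  (exists x y, [/\ vertices D x, vertices D y & is_distance D x y d]) /\
  (forall x y n, vertices D x -> vertices D y -> is_distance D x y n -> n <= d).

Definition connected_diam_le D (d : nat) : Prop :=
  connected_graph D /\ exists2 n, is_diameter D n & n <= d.

End Graphs.

Section Groups.
Variable G : groupType.
Implicit Types (H N : set G) (x y : G).

Definition subgroup H : Prop :=
  [/\ H 1, forall x y, H x -> H y -> H (x * y) & forall x, H x -> H x^-1].

Definition normal_subgroup N : Prop :=
  subgroup N /\ forall x g, N x -> N (x ^ g).

Definition normal_closure x : set G := smallest normal_subgroup [set x].

Definition conj_class x : set G := range (conjg x).

Fixpoint lower_central H (n : nat) : set G :=
  if n is m.+1 then
    smallest subgroup [set [~ a, b] | a in lower_central H m & b in H]
  else H.

Definition nilpotent_subgroup H : Prop :=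
  exists n, lower_central H n = [set 1].

Definition left_coset N x : set G := [set x * n | n in N].

Definition quotient N : set (set G) := range (left_coset N).

(* The group law of [quotient N] for [N] normal. *)
Definition coset_mul (A B : set G) : set G := [set a * b | a in A & b in B].

Definition abelian_quotient N : Prop :=
  forall A B, quotient N A -> quotient N B -> coset_mul A B = coset_mul B A.

(* Some coset gN generates: every coset is (gN)^k = g^k N for an integer k,
   where k = n or k = - n with n : nat. *)
Definition cyclic_quotient N : Prop :=
  exists g, forall A, quotient N A ->
    exists n, A = left_coset N (g ^+ n) \/ A = left_coset N (g ^- n).

(* [x,_k y] *)
Definition engel_commg x y (k : nat) : G := iter k (fun z => [~ z, y]) x.

(* Engel notions are relative to a subgroup H of G, viewed as a group in its
   own right; for the whole group take H := [set: G]. *)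
Definition left_engel H : set G :=
  [set x | H x /\
    forall a, H a -> exists2 k, 0 < k & engel_commg a x k = 1].

Definition non_engel H : Prop := left_engel H <> H.

Definition engel_adj H : rel G := fun x y =>
  `[< [/\ (H `\` left_engel H) x, (H `\` left_engel H) y, x <> y &
      forall k, 0 < k -> engel_commg x y k <> 1 /\ engel_commg y x k <> 1] >].

Lemma engel_adj_vertices H x y :
  engel_adj H x y -> (H `\` left_engel H) x /\ (H `\` left_engel H) y.
Proof. by case/asboolP. Qed.

Lemma engel_adj_sym H : symmetric (engel_adj H).
Proof.
by move=> x y; apply/asboolP/asboolP=> -[Hx Hy nxy E]; split=> //;
  [exact: nesym | move=> k /E[] | exact: nesym | move=> k /E[]].
Qed.

Lemma engel_adj_irrefl H : irreflexive (engel_adj H).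
Proof. by move=> x; apply/asboolP=> -[]. Qed.

Definition engel_graph H : sgraph G :=
  SGraph (@engel_adj_vertices H) (@engel_adj_sym H) (@engel_adj_irrefl H).

End Groups.

Definition nilpotent_by_cyclic (G : groupType) : Prop :=
  exists N : set G,
    [/\ normal_subgroup N, nilpotent_subgroup N & cyclic_quotient N].

Definition nilpotent_by_abelian (G : groupType) : Prop :=
  exists N : set G,
    [/\ normal_subgroup N, nilpotent_subgroup N & abelian_quotient N].

(* Main.v *)
Require Import Defs.
From mathcomp Require Import all_boot all_classical.

Local Open Scope classical_set_scope.

Set Implicit Arguments.
Unset Strict Implicit.
Unset Printing Implicit Defensive.

Local Open Scope group_scope.

(** Let N be a nilpotent normal subgroup of H with H / N abelian, and let
    N' = [N, N].  The factor N / N' is a module over the group ring of H / N,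
    on which n |-> [n, x] acts as x - 1.  Write E(x) for the set of n in N
    such that [n,_k x] lies in N' for some k: modulo N' it is the submodule
    of the elements killed by a power of x - 1.  It contains n as soon as it
    contains [n, x], and it depends only on the coset x N.

    Everything is read off from E(x).
    - If E(x) = N, then x is left Engel ([engel_part_left_engel]).  Indeed the
      commutator map from gamma_i / gamma_{i+1} times N / N' to
      gamma_{i+1} / gamma_{i+2}, where gamma_0 = N, is bilinear, equivariant
      and has generating image, and x - 1 maps a ⊗ b to the sum of (x - 1)a ⊗ b, a ⊗ (x - 1)b
      and (x - 1)a ⊗ (x - 1)b, so that local nilpotence of x - 1 passes from
      N / N' to every factor of the lower central series
      ([engel_part_commg]).
    - If [x, y] lies neither in E(x) nor in E(y), then x and y are adjacent
      ([engel_adj_commg]), because [x,_k y] = [[x, y],_{k-1} y].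

    Hence two elements x, y of one coset of N, not left Engel, are adjacent or
    have a common neighbour x^n with n in N outside E(x): if [x, y] is in
    E(x), then x and y agree modulo E(x), whereas [x, x^n] is not in E(x)
    ([engel_adj_conj]).  This bounds the diameter of a conjugacy class by 2.
    If moreover H / N is generated by g N, then E(g) is contained in E(x) for
    every x, since x acts as a power of g.  If every g v with v in N had
    [x, g v] in E(x), the identity [x, g v] = [x, v][x, g]^v would put [x, v],
    and so v, in E(x) for all v in N; thus every x that is not left Engel has
    a neighbour g v ([engel_adj_coset]).  Any two vertices x and y are
    therefore joined by a walk x, g v, (g v)^n, g w, y, or by the same walk
    without its middle vertex; its length is at most 4.

    For the second part, the normal closure of x is generated by x and its
    intersection with N, so that the cyclic case applies to it; it is not an
    Engel group because it contains the neighbour x^n of x. *)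

(** * Graphs *)

Section Walks.
Variable T : choiceType.
Implicit Type D : sgraph T.

Lemma walk_to_path D x y p : vertices D x -> path (adj D) x p -> last x p = y ->
  exists2 q, path_between D x y q & size q <= size p.
Proof.
move=> Dx pth <-; case/shortenP: pth => q pq uq sub.
exists q => //; apply: uniq_leq_size => [|z /sub //].
by case/andP: uq.
Qed.

(** Loop removal turns walks into paths; the diameter is attained because the
    set of distances is a bounded and nonempty set of integers. *)
Lemma connected_diam_le_walks D d :
    vertices D !=set0 ->
    (forall x y, vertices D x -> vertices D y ->
      exists2 p, path (adj D) x p /\ last x p = y & size p <= d) ->
  connected_diam_le D d.
Proof.
case=> x0 Dx0 walks.
have pathd x y : vertices D x -> vertices D y ->
    exists2 p, path_between D x y p & size p <= d.
  move=> Dx /(walks x y Dx)[p [pp lp] sp].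
  have [q pq sq] := walk_to_path Dx pp lp.
  by exists q => //; apply: leq_trans sp.
split; first by move=> x y Dx /(pathd x y Dx)[p pp _]; exists p.
pose attained := [pred n | `[< exists x y,
  [/\ vertices D x, vertices D y & is_distance D x y n] >]].
have attained0 : exists n, attained n.
  exists 0; apply/asboolP; exists x0, x0; split=> //; split=> //.
  by exists [::].
have attained_le n : attained n -> n <= d.
  move/asboolP=> [x [y [Dx Dy [_ minn]]]].
  by have [p /minn np pd] := pathd _ _ Dx Dy; apply: leq_trans pd.
case: (ex_maxnP attained0 attained_le) => n /[dup] An /asboolP dn maxn.
exists n; last exact: attained_le.
split=> // x y m Dx Dy dm; apply: maxn; apply/asboolP.
by exists x, y.
Qed.

End Walks.

(** * Subgroups and commutators *)

(** Free reduction of left-associated words in group elements and inverses. *)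
Definition wordE (G : groupType) :=
  (@invgM G, @invgK G, @mulgA G, @mulgK G, @mulgVK G, @mulgV G,
   @mulVg G, @mul1g G).

Section Subgroups.
Variable G : groupType.
Implicit Types (A H N : set G) (x y z : G).

Lemma commMg x y z : [~ x * y, z] = [~ x, z] ^ y * [~ y, z].
Proof. by rewrite /commg /conjg !wordE. Qed.

Lemma commgM x y z : [~ x, y * z] = [~ x, z] * [~ x, y] ^ z.
Proof. by rewrite /commg /conjg !wordE. Qed.

Lemma commVg x y : [~ x^-1, y] = ([~ x, y]^-1) ^ x^-1.
Proof. by rewrite /commg /conjg !wordE. Qed.

Lemma commgV x y : [~ x, y^-1] = ([~ x, y]^-1) ^ y^-1.
Proof. by rewrite /commg /conjg !wordE. Qed.

Lemma conj_commg x y : x ^ y = x * [~ x, y].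
Proof. by rewrite commgEl mulVKg. Qed.

Lemma engel_commgS x y k : engel_commg x y k.+1 = [~ engel_commg x y k, y].
Proof. by []. Qed.

Lemma engel_commgSr x y k : engel_commg x y k.+1 = engel_commg [~ x, y] y k.
Proof. exact: iterSr. Qed.

Section Closure.
Variables (A : set G) (sA : subgroup A).

Lemma sg1 : A 1. Proof. by case: sA. Qed.

Lemma sgM x y : A x -> A y -> A (x * y).
Proof. by case: sA => _ + _; apply. Qed.

Lemma sgV x : A x -> A x^-1. Proof. by case: sA => _ _; apply. Qed.

Lemma sgVE x : A x^-1 <-> A x.
Proof. by split=> [/sgV|/sgV //]; rewrite invgK. Qed.

Lemma sgMl x y : A x -> A (x * y) <-> A y.
Proof. by move=> Ax; split=> [/(sgM (sgV Ax))|/(sgM Ax)//]; rewrite mulKg. Qed.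

Lemma sgMr x y : A y -> A (x * y) <-> A x.
Proof.
move=> Ay; split=> [Axy|Ax]; last exact: sgM.
by rewrite -(mulgK y x); apply: sgM (sgV _).
Qed.

Lemma sgX x n : A x -> A (x ^+ n).
Proof.
by move=> Ax; elim: n => [|n IHn]; [exact: sg1 | rewrite expgS; exact: sgM].
Qed.

Lemma sgR x y : A x -> A y -> A [~ x, y].
Proof. by move=> Ax Ay; rewrite /commg conjgE; do ![apply: sgM|apply: sgV]. Qed.

Lemma sgRC x y : A [~ x, y] <-> A [~ y, x].
Proof. by rewrite -invgR sgVE. Qed.

End Closure.

Lemma subgroup_setI A H : subgroup A -> subgroup H -> subgroup (A `&` H).
Proof.
move=> sA sH; split=> [|x y [? ?] [? ?]|x [? ?]].
- by split; apply: sg1.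
- by split; apply: sgM.
- by split; apply: sgV.
Qed.

Lemma subgroup_smallest A : subgroup (smallest (@subgroup G) A).
Proof.
split=> [B [sB _]|x y Ax Ay B [sB AB]|x Ax B [sB AB]]; first exact: sg1.
- by apply: sgM => //; [apply: Ax | apply: Ay].
- by apply: sgV => //; apply: Ax.
Qed.

Lemma mem_generated A x : A x -> smallest (@subgroup G) A x.
Proof. exact: (@sub_gen_smallest _ (@subgroup G) A). Qed.

Definition normalised N H : Prop := forall n h, N n -> H h -> N (n ^ h).

Lemma normalisedR N H n h : subgroup N -> normalised N H -> N n -> H h ->
  N [~ n, h].
Proof.
by move=> sN nNH Nn Hh; apply: sgM; [|apply: sgV|apply: nNH].
Qed.

Lemma normalisedE N H n h : subgroup H -> normalised N H -> H h ->
  N (n ^ h) <-> N n.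
Proof.
move=> sH nNH Hh; split=> [Nnh|Nn]; last exact: nNH.
by rewrite -(conjgK h n); apply: nNH (sgV _ _).
Qed.

End Subgroups.

(** * Abelian quotients and central sections *)

Record abelian_over (G : groupType) (H N : set G) : Prop := AbelianOver {
  over_subgroup : subgroup H;
  under_subgroup : subgroup N;
  under_sub : N `<=` H;
  over_commg : forall h h', H h -> H h' -> N [~ h, h'] }.

(** Typically M = gamma_i(N) and K = gamma_{i+1}(N): the conditions make M / K
    an abelian group on which H acts with N acting trivially. *)
Record central_section (G : groupType) (H N M K : set G) : Prop :=
  CentralSection {
  top_subgroup : subgroup M;
  bottom_subgroup : subgroup K;
  top_sub : M `<=` N;
  bottom_sub : K `<=` M;
  top_normalised : normalised M H;
  bottom_normalised : normalised K H;
  section_commg : forall m n, M m -> N n -> K [~ m, n] }.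

(** * The lower central series *)

Section LowerCentral.
Variable G : groupType.
Variables H N : set G.
Hypothesis aHN : abelian_over H N.
Local Notation L := (lower_central N).

Lemma under_normalised : normalised N H.
Proof.
case: aHN => _ sN NH HHN n h Nn Hh; rewrite conj_commg.
by apply: sgM => //; apply: HHN => //; apply: NH.
Qed.

Lemma lower_central_subgroup i : subgroup (L i).
Proof.
by case: i => [|i] /=; [case: aHN | apply: subgroup_smallest].
Qed.

Lemma lower_central_commg i a b : L i a -> N b -> L i.+1 [~ a, b].
Proof.
move=> La Nb; apply: (@mem_generated G [set [~ a, b] | a in L i & b in N]).
by exists a => //; exists b.
Qed.

Lemma lower_centralS_ind i (A : set G) : subgroup A ->
  (forall a b, L i a -> N b -> A [~ a, b]) -> L i.+1 `<=` A.
Proof.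
by move=> sA LNA; apply: smallest_sub => // _ [a La [b Nb <-]]; apply: LNA.
Qed.

Lemma lower_central_normalised i : normalised (L i) H.
Proof.
elim: i => [|i IHi]; first exact: under_normalised.
move=> n h Ln Hh.
have sL := lower_central_subgroup i.+1.
suff /(_ _ Ln): L i.+1 `<=` [set m | L i.+1 (m ^ h)] by [].
apply: lower_centralS_ind => [|a b La Nb /=].
  split=> [|x y /= Lx Ly|x /= Lx].
  - by rewrite /= conj1g; apply: (sg1 sL).
  - by rewrite conjMg; apply: (sgM sL).
  - by rewrite conjVg; apply: (sgV sL).
rewrite conjRg; apply: lower_central_commg; first exact: IHi.
exact: under_normalised.
Qed.

Lemma lower_central_sub i : L i.+1 `<=` L i.
Proof.
apply: lower_centralS_ind (lower_central_subgroup i) _ => a b La Nb.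
apply: normalisedR (lower_central_subgroup i) _ La (under_sub aHN Nb).
exact: lower_central_normalised.
Qed.

Lemma lower_central_sub0 i : L i `<=` N.
Proof. by elim: i => [|i IHi] // x /lower_central_sub/IHi. Qed.

Lemma lower_central_section i : central_section H N (L i) (L i.+1).
Proof.
split; try exact: lower_central_subgroup; try exact: lower_central_normalised.
- exact: lower_central_sub0.
- exact: lower_central_sub.
- exact: lower_central_commg.
Qed.

(** For fixed a in gamma_i(N), the map b |-> [a, b] is a homomorphism from N to
    the abelian group gamma_{i+1}(N) / gamma_{i+2}(N), so it kills the
    commutators of N.  Comparing [a, b c] with [a, c b [b, c]] makes this
    explicit. *)
Lemma lower_central_commg1 i a d : L i a -> L 1 d -> L i.+2 [~ a, d].
Proof.
move=> La; have sL := lower_central_subgroup i.+2.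
have nL := lower_central_normalised (i := i.+2).
have NH := under_sub aHN.
suff sub : L 1 `<=` [set d | N d /\ L i.+2 [~ a, d]] by move=> /sub[].
have sN := under_subgroup aHN.
apply: lower_centralS_ind.
  split=> [|b c [Nb Lb] [Nc Lc]|b [Nb Lb]]; split.
  - exact: sg1.
  - by rewrite commg1; apply: (sg1 sL).
  - exact: sgM.
  - by rewrite commgM; apply: (sgM sL) => //; apply: nL (NH _ _).
  - exact: sgV.
  - rewrite commgV; apply: nL; first exact: (sgV sL).
    exact: (sgV (over_subgroup aHN) (NH _ _)).
move=> b c Nb Nc; split; first exact: sgR.
have Lp : L i.+1 [~ a, b] by apply: lower_central_commg.
have Lq : L i.+1 [~ a, c] by apply: lower_central_commg.
set p := [~ a, b] in Lp *; set q := [~ a, c] in Lq *; set d0 := [~ b, c].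
have : q * p ^ c = [~ a, d0] * (p * q ^ b) ^ d0.
  by rewrite -!commgM commgC.
rewrite (conj_commg p c) (conj_commg q b) conj_commg.
set r := p * (q * [~ q, b]) => E.
set z := [~ p, c] / ([~ q, b] * [~ r, d0]).
have -> : [~ a, d0] = z ^ (q * p)^-1 * [~ q^-1, p^-1].
  have -> : [~ a, d0] = q * (p * [~ p, c]) / (r * [~ r, d0]) by rewrite E mulgK.
  rewrite /r /z; move: [~ p, c] [~ q, b] [~ _, d0] => u v w.
  by rewrite /commg /conjg !wordE.
have Lcomm m n : L i.+1 m -> N n -> L i.+2 [~ m, n].
  exact: lower_central_commg.
have sL1 := lower_central_subgroup i.+1.
have L1N : L i.+1 `<=` N := @lower_central_sub0 i.+1.
have Nd0 : N d0 by apply: sgR.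
have Lqb : L i.+2 [~ q, b] by exact: Lcomm.
have Lr : L i.+1 r.
  by apply: (sgM sL1) => //; apply: (sgM sL1) => //; apply: lower_central_sub.
have Lz : L i.+2 z.
  exact: (sgM sL (Lcomm _ _ Lp Nc) (sgV sL (sgM sL Lqb (Lcomm _ _ Lr Nd0)))).
have Nqp : N (q * p)^-1 := sgV sN (sgM sN (L1N _ Lq) (L1N _ Lp)).
have Np := sgV sN (L1N _ Lp).
exact: (sgM sL (nL _ _ Lz (NH _ Nqp)) (Lcomm _ _ (sgV sL1 Lq) Np)).
Qed.

End LowerCentral.

Lemma lower_central_mono (G : groupType) (M N : set G) i : M `<=` N ->
  lower_central M i `<=` lower_central N i.
Proof.
move=> MN; elim: i => [|i IHi] //=.
apply: lower_centralS_ind (subgroup_smallest _) _ => a b /IHi La /MN Nb.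
exact: (lower_central_commg (i := i)).
Qed.

(** * Engel elements on an abelian section *)

Section CentralSection.
Variable G : groupType.
Variables H N M K : set G.
Implicit Types (g h n x z : G).
Hypotheses (aHN : abelian_over H N) (cMK : central_section H N M K).

Let sH : subgroup H. Proof. by case: aHN. Qed.
Let sN : subgroup N. Proof. by case: aHN. Qed.
Let NH : N `<=` H. Proof. by case: aHN. Qed.
Let HHN h h' : H h -> H h' -> N [~ h, h'].
Proof. by case: aHN => _ _ _; apply. Qed.
Let sM : subgroup M. Proof. by case: cMK. Qed.
Let sK : subgroup K. Proof. by case: cMK. Qed.
Let MN : M `<=` N. Proof. by case: cMK. Qed.
Let KM : K `<=` M. Proof. by case: cMK. Qed.
Let nMH : normalised M H. Proof. by case: cMK. Qed.
Let nKH : normalised K H. Proof. by case: cMK. Qed.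
Let MNK m n : M m -> N n -> K [~ m, n].
Proof. by case: cMK => _ _ _ _ _ _; apply. Qed.

(** Modulo K, the kernel of (x - 1)^k on the abelian group M / K. *)
Definition engel_layer x k : set G := [set n | M n /\ K (engel_commg n x k)].

Definition engel_part x : set G := [set n | exists k, engel_layer x k n].

(** The inductions on k follow this recursion, which peels off the innermost
    commutator. *)
Lemma engel_layerS x k n : H x ->
  engel_layer x k.+1 n <-> M n /\ engel_layer x k [~ n, x].
Proof.
move=> Hx; rewrite /engel_layer /mkset engel_commgSr.
by split=> [[Mn Kn]|[Mn []]//]; do !split=> //; apply: (normalisedR (H := H)).
Qed.

Lemma engel_layer_ge x k : H x -> K `<=` engel_layer x k.
Proof.
move=> Hx n Kn; split; first exact: (KM).
elim: k => // k IHk; rewrite engel_commgS.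
exact: (normalisedR (H := H)).
Qed.

Lemma engel_layer_conjM x k n m : H x -> subgroup (engel_layer x k) ->
  engel_layer x k n -> N m -> engel_layer x k (n ^ m).
Proof.
move=> Hx sP Pn Nm; rewrite conj_commg; apply: sgM => //.
by apply: engel_layer_ge => //; apply: (MNK) => //; case: Pn.
Qed.

(** The map n |-> [n, x] is a homomorphism only modulo K; the correction terms
    are conjugations by elements of N, harmless since every layer contains K
    and K contains [M, N]. *)
Lemma engel_layer_subgroup x k : H x -> subgroup (engel_layer x k).
Proof.
move=> Hx; elim: k => [|k IHk].
  split=> [|n m [Mn Kn] [Mm Km]|n [Mn Kn]].
  - by split; apply: sg1.
  - by split; apply: sgM.
  - by split; apply: sgV.
have sub n : engel_layer x k.+1 n <-> M n /\ engel_layer x k [~ n, x].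
  exact: engel_layerS.
split=> [|n m /sub[Mn Pn] /sub[Mm Pm]|n /sub[Mn Pn]]; apply/sub.
- by split; [apply: sg1 | rewrite comm1g; apply: sg1].
- split; first exact: sgM.
  rewrite commMg; apply: sgM => //.
  by apply: engel_layer_conjM => //; apply: (MN).
- split; first exact: sgV.
  rewrite commVg; apply: engel_layer_conjM => //; first exact: sgV.
  by apply: sgV => //; apply: (MN).
Qed.

(** Conjugation by h^-1 replaces x by x [x, h^-1], and the factor [x, h^-1]
    lies in N, which acts trivially on M / K. *)
Lemma engel_layer_normalised x k : H x -> normalised (engel_layer x k) H.
Proof.
move=> Hx; elim: k => [|k IHk] n h.
  by case=> Mn Kn Hh; split; [apply: (nMH)|apply: (nKH)].
move=> /(engel_layerS _ _ Hx)[Mn Pn] Hh; apply/(engel_layerS _ _ Hx).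
split; first exact: (nMH).
have HhV : H h^-1 by apply: sgV.
have -> : [~ n ^ h, x] = [~ n, x * [~ x, h^-1]] ^ h.
  by rewrite -conj_commg conjRg -conjgM mulVg conjg1.
apply: (IHk) => //; rewrite commgM.
have Nxh : N [~ x, h^-1] by apply: (HHN).
apply: sgM; [exact: engel_layer_subgroup | | ].
  by apply: engel_layer_ge => //; apply: (MNK).
by apply: IHk => //; apply: (NH).
Qed.

Lemma engel_layer_mono x k l : H x -> k <= l ->
  engel_layer x k `<=` engel_layer x l.
Proof.
move=> Hx /subnK <-; elim: (l - k) => // d IHd n /IHd[Mn Kn]; split=> //.
by rewrite addSn engel_commgS; apply: (normalisedR (H := H)).
Qed.

Lemma engel_part_subgroup x : H x -> subgroup (engel_part x).
Proof.
move=> Hx; split=> [|n m [k Pn] [l Pm]|n [k Pn]].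
- by exists 0; apply: sg1; apply: engel_layer_subgroup.
- exists (maxn k l); apply: sgM; first exact: engel_layer_subgroup.
    by apply: engel_layer_mono Pn => //; apply: leq_maxl.
  by apply: engel_layer_mono Pm => //; apply: leq_maxr.
- by exists k; apply: sgV => //; apply: engel_layer_subgroup.
Qed.

Lemma engel_part_ge x : H x -> K `<=` engel_part x.
Proof. by move=> Hx n Kn; exists 0; apply: engel_layer_ge. Qed.

Lemma engel_part_normalised x : H x -> normalised (engel_part x) H.
Proof. by move=> Hx n h [k Pn] Hh; exists k; apply: engel_layer_normalised. Qed.

(** On the quotient of M by the Engel part, x - 1 is injective. *)
Lemma engel_partR x n : H x -> M n -> engel_part x [~ n, x] <-> engel_part x n.
Proof.
move=> Hx Mn; split=> [[k Pn]|Pn].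
  by exists k.+1; apply/engel_layerS.
apply: (normalisedR (H := H)) => //; first exact: engel_part_subgroup.
exact: engel_part_normalised.
Qed.

Lemma generated_sub_top x : H x -> smallest (@subgroup G) (x |` N) `<=` H.
Proof. by move=> Hx; apply: smallest_sub => // z [->|/NH]. Qed.

(** Modulo N the element z is a power g^j, and g - 1 divides g^j - 1 in the
    group ring, so a power of z - 1 kills what the same power of g - 1 does. *)
Lemma engel_part_le g z : H g -> smallest (@subgroup G) (g |` N) z ->
  engel_part g `<=` engel_part z.
Proof.
move=> Hg gz; have Hz : H z := generated_sub_top Hg gz.
(* The elements y such that [n, y] lies one layer lower form a subgroup,
   which contains g and N. *)
have step k n : engel_layer g k.+1 n -> engel_layer g k [~ n, z].
  move=> Pn; have sP := engel_layer_subgroup k Hg.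
  have nP := engel_layer_normalised (k := k) Hg.
  have [Mn Png] := (engel_layerS k n Hg).1 Pn.
  suff /(_ _ gz)[]: smallest (@subgroup G) (g |` N) `<=`
    [set y | H y /\ engel_layer g k [~ n, y]] by [].
  apply: smallest_sub.
    split=> [|x y [Hx Px] [Hy Py]|x [Hx Px]]; split=> /=.
    - exact: sg1.
    - by rewrite commg1; apply: sg1.
    - exact: sgM.
    - by rewrite commgM; apply: sgM => //; apply: nP.
    - exact: sgV.
    - by rewrite commgV; apply: nP; apply: sgV.
  move=> y [->|Ny]; split=> //; first exact: (NH).
  by apply: engel_layer_ge => //; apply: (MNK).
move=> n [k Pn]; exists k; elim: k n Pn => [|k IHk] n Pn //.
apply/engel_layerS => //; split; first by case: Pn.
exact/IHk/step.
Qed.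

End CentralSection.

(** * Engel action on a nilpotent group *)

Section Nilpotent.
Variable G : groupType.
Variables H N : set G.
Implicit Types (a b n x : G).
Hypothesis aHN : abelian_over H N.
Local Notation L := (lower_central N).
Local Notation layer i := (engel_layer (L i) (L i.+1)).
Local Notation part i := (engel_part (L i) (L i.+1)).

Let cL i : central_section H N (L i) (L i.+1).
Proof. exact: lower_central_section. Qed.

(** The tensor argument: if (x - 1)^k a = 0 and (x - 1)^l b = 0, then a power
    of x - 1 kills [a, b], by induction on k and then on l. *)
Lemma engel_part_commg i x k l a b : H x ->
  layer i x k a -> layer 0 x l b -> part i.+1 x [~ a, b].
Proof.
move=> Hx; have sP j : subgroup (part j x).
  exact: (engel_part_subgroup aHN (cL j) Hx).
have nP j : normalised (part j x) H.
  exact: (engel_part_normalised aHN (cL j) Hx).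
have LP j : L j.+1 `<=` part j x by exact: (engel_part_ge (cL j) Hx).
have NH := under_sub aHN.
have Lab j c d : L j c -> N d -> L j.+1 [~ c, d] by exact: lower_central_commg.
have LN j : L j `<=` N := @lower_central_sub0 G H N aHN j.
elim: k a l b => [|k IHk] a l b.
  by move=> [_ La] [Nb _]; apply: (LP i.+1); exact: (Lab i.+1 _ _ La Nb).
elim: l b => [|l IHl] b Pa.
  move=> [_ Lb]; apply: (LP i.+1); case: Pa => La _.
  exact: (lower_central_commg1 aHN La Lb).
move=> Pb; have [La Pa'] := (engel_layerS (cL i) _ _ Hx).1 Pa.
have [Nb Pb'] := (engel_layerS (cL 0) _ _ Hx).1 Pb.
set a' := [~ a, x] in Pa'; set b' := [~ b, x] in Pb'.
have Na' : N a' by case: Pa' => /LN.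
have Nb' : N b' by case: Pb'.
have Hab : L i.+1 [~ a, b] by apply: Lab.
apply/(engel_partR aHN (cL i.+1)) => //.
(* Since a ^ x = a * a' and b ^ x = b * b', expanding [~ a * a', b * b']
   cancels [~ a, b] and leaves terms with smaller exponents. *)
have -> : [~ [~ a, b], x] = [~ a, b]^-1 *
    ([~ a, b'] ^ a' * [~ a', b'] * ([~ a, b] ^ a' * [~ a', b]) ^ b').
  by rewrite -!commMg -commgM -!conj_commg -conjRg.
rewrite (conjMg ([~ a, b] ^ a')) -(conjgM _ a' b').
rewrite (conj_commg [~ a, b] (a' * b')).
set p := [~ a, b]; set u := _ * [~ a', b'].
have Pu : part i.+1 x u.
  apply: (sgM (sP _)); last exact: IHk Pa' Pb'.
  by apply: nP; [apply: IHl | apply: NH].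
have -> : p^-1 * (u * (p * [~ p, a' * b'] * [~ a', b] ^ b')) =
    u ^ p * ([~ p, a' * b'] * [~ a', b] ^ b').
  by rewrite (conjgE u p) !mulgA.
have Np : N p by apply: LN Hab.
apply: (sgM (sP _)); first by apply: nP => //; apply: NH.
apply: (sgM (sP _)).
  apply: LP; apply: Lab => //.
  exact: (sgM (under_subgroup aHN)).
by apply: nP; [apply: IHk Pa' Pb | apply: NH].
Qed.

Lemma engel_part_lower_central x i : H x -> N `<=` part 0 x ->
  L i `<=` part i x.
Proof.
move=> Hx NP; elim: i => [|i IHi] //.
apply: lower_centralS_ind => [|a b /IHi[k Pa] /NP[l Pb]].
  exact: (engel_part_subgroup aHN (cL _) Hx).
exact: engel_part_commg Pa Pb.
Qed.

Lemma engel_commg_lower_central x n i : H x -> N `<=` part 0 x -> N n ->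
  exists k, L i (engel_commg n x k).
Proof.
move=> Hx NP Nn; elim: i => [|i [k Lk]]; first by exists 0.
have [l [_ Ll]] := engel_part_lower_central Hx NP Lk.
by exists (l + k)%N; rewrite /engel_commg iterD.
Qed.

(** It suffices to look at N, since [a, x] lies in N for every a in H. *)
Lemma engel_part_left_engel x : nilpotent_subgroup N -> H x ->
  N `<=` part 0 x -> left_engel H x.
Proof.
move=> [c Lc] Hx NP; split=> // a Ha.
have [k] := engel_commg_lower_central c Hx NP (over_commg aHN Ha Hx).
by rewrite Lc => ak; exists k.+1; rewrite // engel_commgSr.
Qed.

End Nilpotent.

(** * The Engel graph *)

Section EngelGraph.
Variable G : groupType.
Variables H N : set G.
Implicit Types (g h n x y z : G).
Hypotheses (aHN : abelian_over H N) (nilN : nilpotent_subgroup N).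
Local Notation E := (engel_part N (lower_central N 1)).

Let cN : central_section H N N (lower_central N 1).
Proof. exact: (lower_central_section aHN 0). Qed.
Let sH : subgroup H. Proof. by case: aHN. Qed.
Let sN : subgroup N. Proof. by case: aHN. Qed.
Let sE x : H x -> subgroup (E x).
Proof. exact: (engel_part_subgroup aHN cN). Qed.
Let nE x : H x -> normalised (E x) H.
Proof. exact: (engel_part_normalised aHN cN). Qed.

Lemma not_left_engel_exists x : H x -> ~ left_engel H x ->
  exists2 n, N n & ~ E x n.
Proof.
move=> Hx xNE; apply: contrapT => nex; apply: xNE.
apply: (engel_part_left_engel aHN nilN Hx) => n Nn.
by apply: contrapT => En; apply: nex; exists n.
Qed.

Lemma engel_commg_neq1 x z k : H x -> N z -> ~ E x z -> engel_commg z x k <> 1.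
Proof.
move=> Hx Nz Ez zk; apply: Ez; exists k; split=> //=.
by rewrite zk; apply: (sg1 (bottom_subgroup cN)).
Qed.

Lemma engel_commg_not_left_engel x y : H x -> H y ->
  (forall k, 0 < k -> engel_commg y x k <> 1) -> ~ left_engel H x.
Proof. by move=> Hx Hy yxk [_ /(_ y Hy)[k /yxk]]. Qed.

Lemma engel_adj_commg x y : H x -> H y -> ~ E x [~ x, y] -> ~ E y [~ x, y] ->
  engel_adj H x y.
Proof.
move=> Hx Hy Ex Ey.
have xyk k : 0 < k -> engel_commg x y k <> 1.
  case: k => // k _; rewrite engel_commgSr.
  by apply: engel_commg_neq1 => //; apply: (over_commg aHN).
have yxk k : 0 < k -> engel_commg y x k <> 1.
  case: k => // k _; rewrite engel_commgSr.
  apply: engel_commg_neq1 => //; first exact: (over_commg aHN).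
  by rewrite (sgRC (sE Hx)).
apply/asboolP; split.
- by split=> //; apply: engel_commg_not_left_engel yxk.
- by split=> //; apply: engel_commg_not_left_engel xyk.
- by move=> xy; apply: Ex; rewrite xy commgg; apply: (sg1 (sE Hy)).
- by move=> k k0; split; [apply: xyk | apply: yxk].
Qed.

Lemma engel_part_coset x n : H x -> N n -> E (x * n) = E x.
Proof.
move=> Hx Nn; have Hn := under_sub aHN Nn; have Hxn := sgM sH Hx Hn.
have gen y : smallest (@subgroup G) (y |` N) y by apply: mem_generated; left.
have genN y z : N z -> smallest (@subgroup G) (y |` N) z.
  by move=> Nz; apply: mem_generated; right.
have sgen y : subgroup (smallest (@subgroup G) (y |` N)).
  exact: subgroup_smallest.
apply/seteqP; split; apply: (engel_part_le aHN cN) => //.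
  rewrite -[X in _ X](mulgK n x).
  exact: (sgM (sgen _) (gen _) (genN _ _ (sgV sN Nn))).
exact: (sgM (sgen _) (gen _) (genN _ _ Nn)).
Qed.

(** For y = x v one has [x, y] = [x, v], so x and y are adjacent unless v lies
    in E(x).  In that case y behaves like x modulo E(x), and any n outside
    E(x) makes x ^ n adjacent to both. *)
Lemma engel_adj_conj x y : H x -> N (x^-1 * y) -> ~ left_engel H x ->
  engel_adj H x y \/
  exists2 n, N n & engel_adj H x (x ^ n) /\ engel_adj H (x ^ n) y.
Proof.
move=> Hx Nxy xNE; set v := x^-1 * y in Nxy.
have ->: y = x * v by rewrite /v mulVKg.
have Hv := under_sub aHN Nxy; have Hxv := sgM sH Hx Hv.
have [n Nn En] := not_left_engel_exists Hx xNE.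
have Hn := under_sub aHN Nn.
have Nxn : N [~ x, n] by apply: (over_commg aHN).
have Hxn : H (x ^ n).
  by rewrite conj_commg; apply: sgM => //; apply: (under_sub aHN).
have Ev : E (x * v) = E x by exact: engel_part_coset.
have Exn : E (x ^ n) = E x by rewrite conj_commg; exact: engel_part_coset.
have [Exv|Exv] := pselect (E x [~ x, x * v]); last first.
  by left; apply: engel_adj_commg => //; rewrite Ev.
right; exists n => //.
have nExn : ~ E x [~ x, x ^ n].
  rewrite conj_commg commgM commgg conj1g mulg1 (sgRC (sE Hx)).
  rewrite (engel_partR aHN cN) // (sgRC (sE Hx)).
  by rewrite (engel_partR aHN cN).
suff nExnv : ~ E x [~ x ^ n, x * v].
  by split; apply: engel_adj_commg => //; rewrite ?Exn ?Ev.
have {}Exv : E x v.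
  move: Exv; rewrite commgM commgg conj1g mulg1 (sgRC (sE Hx)).
  by rewrite (engel_partR aHN cN).
rewrite commgM (sgMl (sE Hx)); last first.
  by rewrite (sgRC (sE Hx)); apply: (normalisedR (sE Hx) (nE Hx)).
by rewrite (normalisedE _ sH (nE Hx)) // (sgRC (sE Hx)).
Qed.

(** The inclusion of E(g) in E(x) reduces adjacency of x and g v to
    [x, g v] not in E(x).  Either v = 1 works, or [x, g] is in E(x) and then
    any v outside E(x) works. *)
Lemma engel_adj_coset g x : H g -> H x -> smallest (@subgroup G) (g |` N) x ->
  ~ left_engel H x -> exists2 v, N v & engel_adj H x (g * v).
Proof.
move=> Hg Hx gx xNE; have Egx := engel_part_le aHN cN Hg gx.
suff [v Nv Ev] : exists2 v, N v & ~ E x [~ x, g * v].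
  exists v => //; apply: engel_adj_commg => //.
    by apply: sgM => //; apply: (under_sub aHN).
  by rewrite engel_part_coset // => /Egx.
have [Exg|Exg] := pselect (E x [~ x, g]); last first.
  by exists 1; [apply: sg1 | rewrite mulg1].
have [n Nn En] := not_left_engel_exists Hx xNE.
exists n => //; rewrite commgM (sgMr (sE Hx)).
  by rewrite (sgRC (sE Hx)) (engel_partR aHN cN).
by apply: nE => //; apply: (under_sub aHN).
Qed.

Lemma connected_engel_graph g : H g -> H `<=` smallest (@subgroup G) (g |` N) ->
  non_engel H -> connected_diam_le (engel_graph H) 6.
Proof.
move=> Hg gH nonE; apply: connected_diam_le_walks.
  apply: contrapT => no; apply: nonE; apply/seteqP; split=> [x []//|x Hx].
  by apply: contrapT => xNE; apply: no; exists x.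
move=> x y [Hx xNE] [Hy yNE] /=.
have [v Nv xv] := engel_adj_coset Hg Hx (gH _ Hx) xNE.
have [w Nw yw] := engel_adj_coset Hg Hy (gH _ Hy) yNE.
have [_ [Hgv gvNE]] := engel_adj_vertices xv.
have Nvw : N ((g * v)^-1 * (g * w)).
  by rewrite invgM -mulgA mulKg; apply: sgM => //; apply: (sgV sN).
rewrite engel_adj_sym in yw.
have [vw|[n Nn [vn nw]]] := engel_adj_conj Hgv Nvw gvNE.
  by exists [:: g * v; g * w; y] => //=; rewrite xv vw yw.
by exists [:: g * v; (g * v) ^ n; g * w; y] => //=; rewrite xv vn nw yw.
Qed.

End EngelGraph.

(** * Quotients by cosets *)

Section Quotients.
Variable G : groupType.
Variable N : set G.
Hypothesis nN : normal_subgroup N.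
Implicit Types (g x y : G).

Let sN : subgroup N. Proof. by case: nN. Qed.
Let nNT x g : N x -> N (x ^ g). Proof. by case: nN => _; apply. Qed.

Lemma left_coset_refl x : left_coset N x x.
Proof. by exists 1; [apply: sg1 | rewrite mulg1]. Qed.

Lemma abelian_quotient_over : abelian_quotient N -> abelian_over [set: G] N.
Proof.
move=> ab; split=> // x y _ _.
have : coset_mul (left_coset N x) (left_coset N y) (x * y).
  exists x; first exact: left_coset_refl.
  by exists y => //; apply: left_coset_refl.
rewrite ab; [|by exists x|by exists y].
move=> [_ [n Nn <-] [_ [m Nm <-] E]].
have -> : [~ x, y] = n ^ x * m.
  rewrite /commg conjgE mulgA -invgM -E !mulgA conjgE.
  by rewrite !wordE.
by apply: sgM => //; apply: nNT.
Qed.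

Lemma cyclic_quotient_generated : cyclic_quotient N ->
  exists g, [set: G] `<=` smallest (@subgroup G) (g |` N).
Proof.
move=> [g gen]; exists g => h _.
have sS := subgroup_smallest (g |` N).
have Sg : smallest (@subgroup G) (g |` N) g.
  by apply: mem_generated; left.
have SN x : N x -> smallest (@subgroup G) (g |` N) x.
  by move=> Nx; apply: mem_generated; right.
have [n nE] := gen (left_coset N h) (ex_intro2 _ _ h I erefl).
have := left_coset_refl h.
case: nE => -> [m Nm <-].
  exact: (sgM sS (sgX sS n Sg) (SN _ Nm)).
exact: (sgM sS (sgV sS (sgX sS n Sg)) (SN _ Nm)).
Qed.

(** The elements centralising a given set modulo N form a subgroup containing
    N; this is applied first to the set {g} and then to the whole group. *)
Lemma generated_abelian_over g :
  [set: G] `<=` smallest (@subgroup G) (g |` N) -> abelian_over [set: G] N.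
Proof.
move=> gen; split=> // x y _ _.
have cent (A : set G) : subgroup [set z | forall a, A a -> N [~ a, z]].
  split=> [a _|z w Az Aw a Aa|z Az a Aa].
  - by rewrite commg1; apply: sg1.
  - by rewrite commgM; apply: sgM; [|apply: Aw|apply/nNT/Az].
  - by rewrite commgV; apply/nNT/(sgV sN)/Az.
have NR a b : N b -> N [~ a, b].
  by move=> Nb; rewrite (sgRC sN) commgEl; apply: sgM; [|apply: sgV|apply: nNT].
have all_g z : N [~ g, z].
  suff sub : [set: G] `<=` [set z | forall a, [set g] a -> N [~ a, z]].
    exact: (sub z I).
  apply: (subset_trans gen); apply: smallest_sub; first exact: cent.
  by move=> w [->|Nw] a ->; [rewrite commgg; apply: sg1|apply: NR].
suff sub : [set: G] `<=` [set z | forall a, [set: G] a -> N [~ a, z]].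
  exact: (sub y I).
apply: (subset_trans gen); apply: smallest_sub; first exact: cent.
by move=> w [->|Nw] a _; [rewrite (sgRC sN); apply: all_g|apply: NR].
Qed.

End Quotients.

(** * Normal closures and conjugacy classes *)

Section NormalClosure.
Variable G : groupType.
Variable N : set G.
Hypotheses (aN : abelian_over [set: G] N) (nilN : nilpotent_subgroup N).
Implicit Types (g x y : G).
Local Notation C x := (normal_closure x).

Let sN : subgroup N. Proof. by case: aN. Qed.

Lemma normal_closure_normal x : normal_subgroup (C x).
Proof.
split; first split.
- by move=> A [[[A1]]].
- by move=> y z Cy Cz A A_; case: (A_) => [[sA _] _]; apply: (sgM sA);
    [apply: Cy | apply: Cz].
- by move=> y Cy A A_; case: (A_) => [[sA _] _]; apply: (sgV sA); apply: Cy.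
- by move=> y g Cy A A_; case: (A_) => [[_ nA] _]; apply: nA; apply: Cy.
Qed.

Lemma normal_closure_id x : C x x.
Proof. by move=> A [_]; apply. Qed.

Lemma normal_closure_over x : abelian_over (C x) (N `&` C x).
Proof.
have [sC nC] := normal_closure_normal x.
split=> //; first exact: subgroup_setI.
by move=> y z Cy Cz; split; [apply: (over_commg aN) | apply: (sgR sC)].
Qed.

(** The right-hand side meets the normal closure in a normal subgroup: for y
    in it, y ^ g = y [y, g] and [y, g] lies in N. *)
Lemma normal_closure_generated x :
  C x `<=` smallest (@subgroup G) (x |` (N `&` C x)).
Proof.
have [sC nC] := normal_closure_normal x; set S := smallest _ _.
have sS : subgroup S := subgroup_smallest _.
have Sx : S x.
  by apply: mem_generated; left.
suff: C x `<=` S `&` C x by move=> sub y /sub[].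
apply: smallest_sub; last by move=> _ ->; split=> //; apply: normal_closure_id.
split; first exact: subgroup_setI.
move=> y g [Sy Cy]; split; last exact: nC.
rewrite conj_commg; apply: (sgM sS) => //.
apply: mem_generated; right; split; first exact: (over_commg aN).
by rewrite commgEl; apply: (sgM sC); [apply: (sgV sC) | apply: nC].
Qed.

Lemma nilpotent_subgroup_sub M : M `<=` N -> subgroup M -> nilpotent_subgroup M.
Proof.
move=> MN sM; have [c Nc] := nilN; exists c; apply/seteqP; split=> [x Mx|_ ->].
  by rewrite -Nc; apply: lower_central_mono Mx.
by case: c {Nc} => [|c]; [apply: sg1 | apply: (sg1 (subgroup_smallest _))].
Qed.

(** The witness is a neighbour x ^ n of x, which lies in the normal closure. *)
Lemma normal_closure_non_engel x : ~ left_engel [set: G] x -> non_engel (C x).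
Proof.
move=> xNE eqC; have [sC nC] := normal_closure_normal x.
have Cx : C x x by exact: normal_closure_id.
have Nxx : N (x^-1 * x) by rewrite mulVg; apply: sg1.
have [|[n Nn [/asboolP[_ _ _ xn] _]]] := engel_adj_conj aN nilN I Nxx xNE.
  by rewrite (engel_adj_irrefl [set: G]).
have : left_engel (C x) x by rewrite eqC.
by case=> _ /(_ (x ^ n) (nC x n Cx))[k /xn[]].
Qed.

Lemma left_engelJ x g : left_engel [set: G] (x ^ g) -> left_engel [set: G] x.
Proof.
move=> [_ xg]; split=> // a _; have [k k0 ak] := xg (a ^ g) I.
exists k => //; apply: (@conjg_inj _ g); rewrite conj1g -ak.
by elim: k {k0 ak} => //= k <-; rewrite conjRg.
Qed.

Lemma connected_conj_class x : ~ left_engel [set: G] x ->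
  connected_diam_le (induced (engel_graph [set: G]) (conj_class x)) 2.
Proof.
move=> xNE; apply: connected_diam_le_walks.
  by exists x; split=> //=; exists 1; rewrite ?conjg1.
move=> _ _ [_ [a _ <-]] [_ [b _ <-]].
have inC g : x ^ g \in conj_class x by apply/mem_set; exists g.
have Nab : N ((x ^ a)^-1 * x ^ b).
  rewrite !conj_commg invgM -mulgA mulKg.
  have Nx g : N [~ x, g] by exact: (over_commg aN).
  exact: (sgM sN (sgV sN (Nx a)) (Nx b)).
have xaNE : ~ left_engel [set: G] (x ^ a) by move/left_engelJ.
have [ab|[n Nn [an nb]]] := engel_adj_conj aN nilN I Nab xaNE.
  by exists [:: x ^ b] => //=; rewrite ab !inC.
by exists [:: (x ^ a) ^ n; x ^ b] => //=; rewrite an nb -conjgM !inC.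
Qed.

End NormalClosure.

Theorem theorem2p4 (G : groupType) :
  (nilpotent_by_cyclic G -> non_engel [set: G] ->
     connected_diam_le (engel_graph [set: G]) 6) /\
  (nilpotent_by_abelian G -> forall x : G, ~ left_engel [set: G] x ->
     [/\ non_engel (normal_closure x),
         connected_diam_le (engel_graph (normal_closure x)) 6 &
         connected_diam_le (induced (engel_graph [set: G]) (conj_class x)) 2]).
Proof.
split=> [[N [nN nilN cN]] nonE|[N [nN nilN abN]] x xNE].
  have [g gen] := cyclic_quotient_generated nN cN.
  by apply: (connected_engel_graph (generated_abelian_over nN gen) nilN I gen).
have aN := abelian_quotient_over nN abN.
have nonE := normal_closure_non_engel aN nilN xNE.
have aC := normal_closure_over aN x.
split=> //; last exact: (connected_conj_class aN nilN xNE).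
apply: (connected_engel_graph aC) nonE.
- exact: (nilpotent_subgroup_sub nilN (@subIsetl _ _ _) (under_subgroup aC)).
- exact: normal_closure_id.
- exact: normal_closure_generated.
Qed.
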